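(* Let $T$ be a tree rooted at $o$, let $X$ be either $\mathcal{L}_{\mathbf{w}}$ or $\mathcal{L}_{\mathbf{w},0}$, and let $\psi:T\to\mathbb{C}$ be such that $M_\psi$ is bounded on $\mathcal{L}_{\mathbf{w}}$ (or equivalently, on $\mathcal{L}_{\mathbf{w},0}$). Then the essential norm of $M_\psi$ on $X$ satisfies $$\|M_\psi\|_e\le A(\psi)+B(\psi),$$ where $A(\psi)=\lim_{n\to\infty}\sup_{|v|\ge n}|\psi(v)|$ and $B(\psi)=\lim_{n\to\infty}\sup_{|v|\ge n}|v|\log|v|\,D\psi(v)$.
   Context: A tree $T$ is a locally finite, connected, simply-connected graph, identified with its set of vertices; $T$ is assumed to have no terminal vertices (vertices with exactly one neighbor), so it is infinite, and it is rooted at a vertex $o$. $|v|$ is the number of edges in the unique path from $o$ to $v$; $T^*=T\setminus\{o\}$; for $v\in T^*$, $v^-$ is the neighbor of $v$ closest to $o$. For $f:T\to\mathbb{C}$ and $v\in T^*$, $Df(v)=|f(v)-f(v^-)|$. The weighted Lipschitz space $\mathcal{L}_{\mathbf{w}}$ is the set of $f:T\to\mathbb{C}$ with $\sup_{v\in T^*}|v|Df(v)<\infty$, normed by $\|f\|_{\mathbf{w}}=|f(o)|+\sup_{v\in T^*}|v|Df(v)$ (a Banach space). The little weighted Lipschitz space $\mathcal{L}_{\mathbf{w},0}$ is the closed subspace of those $f\in\mathcal{L}_{\mathbf{w}}$ with $\lim_{|v|\to\infty}|v|Df(v)=0$. $M_\psi f=\psi f$ (pointwise product); ''$M_\psi$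 is bounded on $X$'' means $M_\psi$ maps $X$ into $X$ and is a bounded linear operator there. The essential norm of a bounded operator $S$ on a Banach space $X$ is $\|S\|_e=\inf\{\|S-K\|: K\text{ compact operator on }X\}$. *)

(* Defs.v *)
From HB Require Import structures.
From mathcomp Require Import all_boot all_order all_algebra.
From mathcomp Require Import complex.
From mathcomp Require Import all_classical all_reals all_analysis.
Set Implicit Arguments.
Unset Strict Implicit.
Unset Printing Implicit Defensive.
Import Order.TTheory GRing.Theory Num.Theory.
Import numFieldNormedType.Exports.

Local Open Scope classical_set_scope.
Local Open Scope ring_scope.
Local Open Scope complex_scope.

(* A simple cycle of [path.v] may have length 1 or 2; those of length 1 are
   excluded by irreflexivity, and [:: x; y] just walks an edge back and forth.
   "No vertex with exactly one neighbor" alone would admit the one-vertex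
   graph, hence [tree_infinite]. *)
Record tree := Tree {
  vertex :> choiceType;
  adj : rel vertex;
  root : vertex;
  adj_sym : symmetric adj;
  adj_irr : irreflexive adj;
  adj_locally_finite : forall v, finite_set [set w | adj v w];
  adj_connected : forall u v, exists p, path adj u p /\ last u p = v;
  adj_acyclic : forall s, ucycle adj s -> (size s <= 2)%N;
  adj_no_terminal : forall v, ~ exists w, [set u | adj v u] = [set w];
  tree_infinite : infinite_set [set: vertex]
}.
Arguments root {t}.

Section tree_metric.
Variable T : tree.
Implicit Types v w : T.

Definition root_path v : seq T :=
  xget [::] [set p | [/\ path (@adj T) root p, last root p = v &
                         uniq (root :: p)]].

(* |v| *)
Definition depth v : nat := size (root_path v).

(* v^-; the default is only taken at the root *)
Definition parent v : T :=
  if v == root then root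
  else xget root
    [set w | adj v w /\ forall u, adj v u -> (depth w <= depth u)%N].

End tree_metric.

Section lipschitz.
Variables (R : realType) (T : tree).
Implicit Types f g : T -> R[i].

(* Df(v), real-valued; meaningful for v != root (and 0 at the root) *)
Definition Dmod f (v : T) : R := Normc.normc (f v - f (parent v)).

Definition wDmod f (v : T) : R := (depth v)%:R * Dmod f v.

Definition wDmods f : set R := [set wDmod f v | v in [set v | v != root]].

Definition wnorm f : R := Normc.normc (f root) + sup (wDmods f).

Definition wvanish f : Prop :=
  forall e : R, 0 < e ->
  exists n : nat, forall v : T, (n <= depth v)%N -> wDmod f v < e.

End lipschitz.

Section tree_facts.
Variable T : tree.
Implicit Types v w : T.

Lemma no_bigon v x (p q : seq T) :
  path (@adj T) v (rcons p x) -> path (@adj T) v (rcons q x) ->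
  uniq (v :: rcons p x) -> uniq (v :: rcons q x) -> ~~ has (mem q) p ->
  p = [::] /\ q = [::].
Proof.
move=> pp pq up uq npq.
have : ucycle (@adj T) (v :: rcons p x ++ rev q).
  apply/andP; split.
    rewrite /cycle rcons_cat cat_path pp last_rcons -rev_cons.
    move: pq; rewrite -rev_path last_rcons belast_rcons.
    by rewrite (eq_path (e' := @adj T))// => y z; rewrite adj_sym.
  rewrite -cat_cons cat_uniq up rev_uniq /=.
  move: uq; rewrite /= mem_rcons inE negb_or rcons_uniq.
  case/and3P=> /andP[vx vq] xq ->; rewrite andbT has_rev.
  rewrite -all_predC; apply/allP => y yq /=.
  rewrite inE mem_rcons inE !negb_or.
  apply/and3P; split.
  - by apply: contraNneq vq => <-.
  - by apply: contraNneq xq => <-.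
  - by apply: contra npq => yp; apply/hasP; exists y.
move/adj_acyclic; rewrite /= size_cat size_rcons size_rev.
by rewrite addSn !ltnS leqn0 addn_eq0 !size_eq0 => /andP[/eqP-> /eqP->].
Qed.

Lemma simple_path_unique v (p q : seq T) :
  path (@adj T) v p -> path (@adj T) v q -> uniq (v :: p) -> uniq (v :: q) ->
  last v p = last v q -> p = q.
Proof.
elim: p v q => [|a p IH] v q.
  case: q => // b q _ _ _ /= /andP[/negP nv _] E.
  by case: nv; rewrite E mem_last.
case: q => [|b q].
  by move=> _ _ /= /andP[/negP nv _] _ E; case: nv; rewrite -E mem_last.
move=> pp pq up uq E.
have [ab|ab] := eqVneq a b.
  move: pp pq up uq E; rewrite -ab => /andP[_ pa] /andP[_ qa].
  by move=> /andP[_ up] /andP[_ uq] /(IH _ _ pa qa up uq) ->.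
exfalso.
have hasq : has (mem (b :: q)) (a :: p).
  apply/hasP; exists (last a p); first exact: mem_last.
  by move: E => /= ->; exact: mem_last.
have [p1 [x [p2 [Ep xq np1]]]] : exists p1 x p2,
    [/\ a :: p = rcons p1 x ++ p2, x \in b :: q & ~~ has (mem (b :: q)) p1].
  by case/split_find: hasq => x p1 p2 xq np1; exists p1, x, p2.
have [q1 [q2 Eq]] : exists q1 q2, b :: q = rcons q1 x ++ q2.
  by case/splitPr: xq => q1 q2; exists q1, q2; rewrite cat_rcons.
have [p10 q10] : p1 = [::] /\ q1 = [::].
  apply: (@no_bigon v x).
  - by move: pp; rewrite Ep cat_path => /andP[].
  - by move: pq; rewrite Eq cat_path => /andP[].
  - by move: up; rewrite Ep -cat_cons cat_uniq => /and3P[].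
  - by move: uq; rewrite Eq -cat_cons cat_uniq => /and3P[].
  - apply: contra np1 => /hasP[y yp yq]; apply/hasP; exists y => //=.
    by rewrite Eq mem_cat mem_rcons inE [y \in q1]yq orbT.
move: Ep Eq; rewrite p10 q10 /= => -[ax _] [bx _].
by move: ab; rewrite ax bx eqxx.
Qed.

Lemma root_pathP v :
  [/\ path (@adj T) root (root_path v), last root (root_path v) = v &
      uniq (root :: root_path v)].
Proof.
rewrite /root_path; case: xgetP => [p _ //|no]; exfalso.
have [p [pp lp]] := adj_connected root v.
case/shortenP: pp lp => q qp uq _ lq.
exact: (no q).
Qed.

Lemma depth_path v (p : seq T) :
  path (@adj T) root p -> last root p = v -> uniq (root :: p) ->
  depth v = size p.
Proof.
move=> pp lp up; have [qp ql qu] := root_pathP v.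
by rewrite /depth (simple_path_unique qp pp qu up)// ql lp.
Qed.

Lemma depth_root : depth (root : T) = 0%N.
Proof. exact: (depth_path (p := [::])). Qed.

Lemma parent_root : parent (root : T) = root.
Proof. by rewrite /parent eqxx. Qed.

Lemma exists_lower_neighbor v : v != root ->
  exists2 w, adj v w & depth v = (depth w).+1.
Proof.
have [] := root_pathP v; case/lastP E : (root_path v) => [|p x].
  by move=> _ <-; rewrite eqxx.
rewrite last_rcons rcons_path => /andP[pp pe] xv up _; exists (last root p).
  by rewrite adj_sym -xv.
rewrite /depth E size_rcons; congr S; apply/esym/depth_path => //.
by move: up; rewrite -rcons_cons rcons_uniq => /andP[].
Qed.

Lemma parentP v : v != root ->
  adj v (parent v) /\ forall u, adj v u -> (depth (parent v) <= depth u)%N.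
Proof.
move=> vr; rewrite /parent (negbTE vr); case: xgetP => [w _ //|no]; exfalso.
have [w vw _] := exists_lower_neighbor vr.
have ex : exists n, `[< exists2 w, adj v w & depth w = n >].
  by exists (depth w); apply/asboolP; exists w.
case: (ex_minnP ex) => n /asboolP[u vu un] mn.
apply: (no u); split=> // z vz; rewrite un; apply: mn; apply/asboolP.
by exists z.
Qed.

Lemma depth_parent_lt v : v != root -> (depth (parent v) < depth v)%N.
Proof.
move=> vr; have [w vw ->] := exists_lower_neighbor vr.
by rewrite ltnS; have [_] := parentP vr; apply.
Qed.

Lemma depth_gt0 v : v != root -> (0 < depth v)%N.
Proof. by move=> /depth_parent_lt; exact: leq_trans. Qed.

End tree_facts.

(* The two spaces L_w and L_{w,0} *)
Inductive lip_kind := Lw | Lw0.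

Section lip_space.
Variables (R : realType) (T : tree) (k : lip_kind).

Definition in_lip (f : T -> R[i]) : Prop :=
  has_ubound (wDmods f) /\ match k with Lw => True | Lw0 => wvanish f end.

Definition lip_pred : {pred T -> R[i]} := fun f => `[< in_lip f >].

Record lip := Lip { lip_fun :> T -> R[i]; lip_funP : lip_fun \in lip_pred }.

HB.instance Definition _ := [isSub for lip_fun].
HB.instance Definition _ := [Choice of lip by <:].

End lip_space.

Section lip_facts.
Variables (R : realType) (T : tree).
Implicit Types f g : T -> R[i].

Lemma fun_scaleE (a : R[i]) f v : (a *: f) v = a * f v.
Proof. by []. Qed.

Lemma normc_ge0 (z : R[i]) : 0 <= Normc.normc z.
Proof. by rewrite -lecR; exact: (@normr_ge0 _ R[i]). Qed.

Lemma wDmod_ge0 f v : 0 <= wDmod f v.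
Proof. by rewrite mulr_ge0 ?ler0n// normc_ge0. Qed.

Lemma wDmodD f g v : wDmod (f + g) v <= wDmod f v + wDmod g v.
Proof.
rewrite /wDmod -mulrDr ler_wpM2l ?ler0n// /Dmod.
have -> : (f + g) v - (f + g) (parent v) =
  (f v - f (parent v)) + (g v - g (parent v)) by rewrite opprD addrACA.
exact: le_normcD.
Qed.

Lemma wDmodZ a f v : wDmod (a *: f) v = Normc.normc a * wDmod f v.
Proof.
by rewrite /wDmod /Dmod !fun_scaleE -mulrBr Normc.normcM mulrCA.
Qed.

Lemma wDmods_neq0 f : wDmods f !=set0.
Proof.
apply/set0P/eqP => H; apply: (tree_infinite (t := T)).
apply: (@sub_finite_set _ _ [set root]) => [v _ /=|]; last exact: finite_set1.
apply/eqP/negP => /negP vr.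
have : wDmods f (wDmod f v) by exists v.
by rewrite H.
Qed.

Lemma in_lip_sup k f : in_lip k f -> has_sup (wDmods f).
Proof. by move=> [? _]; split=> //; exact: wDmods_neq0. Qed.

Lemma wDmod_le k f v : in_lip k f -> v != root -> wDmod f v <= sup (wDmods f).
Proof. by move=> /in_lip_sup [_ h] vr; apply: ub_le_sup => //; exists v. Qed.

Lemma lip_submod_closed k : submod_closed (@lip_pred R T k).
Proof.
split=> [|a f g].
  apply/asboolP; have z v : wDmod (0 : T -> R[i]) v = 0.
    by rewrite /wDmod /Dmod subrr Normc.normc0 mulr0.
  split; first by exists 0 => _ [v _ <-]; rewrite z.
  by case: k => // e e0; exists 0%N => v _; rewrite z.
move=> /asboolP [[M fM] fk] /asboolP [[N gN] gk]; apply/asboolP.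
have le v : wDmod (a *: f + g) v <= Normc.normc a * wDmod f v + wDmod g v.
  by rewrite -wDmodZ wDmodD.
have a0 := normc_ge0 a.
split.
  exists (Normc.normc a * M + N) => _ [v vr <-].
  apply: (le_trans (le v)); apply: lerD; last by apply: gN; exists v.
  by apply: ler_wpM2l => //; apply: fM; exists v.
case: k fk gk => // fk gk e e0.
have b0 : 0 < Normc.normc a + 1 by rewrite ltr_wpDl.
have [m fm] := fk (e / 2 / (Normc.normc a + 1)) ltac:(by rewrite !divr_gt0).
have [n gn] := gk (e / 2) ltac:(by rewrite divr_gt0).
exists (maxn m n) => v; rewrite geq_max => /andP[mv nv].
apply: (le_lt_trans (le v)); rewrite [ltRHS](splitr e).
apply: ler_ltD; last exact: gn.
apply: (@le_trans _ _ ((Normc.normc a + 1) * wDmod f v)).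
  by rewrite ler_wpM2r ?wDmod_ge0// lerDl.
by rewrite -ler_pdivlMl// mulrC ltW// fm.
Qed.

End lip_facts.

HB.instance Definition _ (R : realType) (T : tree) (k : lip_kind) :=
  GRing.isSubmodClosed.Build R[i] (T -> R[i]) (@lip_pred R T k)
    (@lip_submod_closed R T k).

HB.instance Definition _ (R : realType) (T : tree) (k : lip_kind) :=
  [SubChoice_isSubLmodule of lip R T k by <:].

Section lip_norm.
Variables (R : realType) (T : tree) (k : lip_kind).
Implicit Types f g : lip R T k.

Definition lip_norm f : R[i] := (wnorm f)%:C.

Let lipP f : in_lip k f.
Proof. by apply/asboolP; exact: lip_funP. Qed.

Lemma lip_normD f g : lip_norm (f + g) <= lip_norm f + lip_norm g.
Proof.
rewrite /lip_norm -rmorphD/= lecR /wnorm addrACA; apply: lerD.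
  exact: le_normcD.
apply: ge_sup => [|_ [v vr <-]]; first exact: wDmods_neq0.
apply: (le_trans (wDmodD f g v)).
by apply: lerD; exact: wDmod_le.
Qed.

Lemma lip_normZ (a : R[i]) f : lip_norm (a *: f) = `|a| * lip_norm f.
Proof.
have -> : `|a| = (Normc.normc a)%:C by [].
rewrite /lip_norm -rmorphM/=; congr (_%:C); rewrite /wnorm mulrDr.
congr (_ + _); first by rewrite -Normc.normcM.
have a0 := normc_ge0 a.
apply/eqP; rewrite eq_le; apply/andP; split.
  apply: ge_sup => [|_ [v vr <-]]; first exact: wDmods_neq0.
  rewrite (wDmodZ a f v); apply: ler_wpM2l => //; exact: wDmod_le.
have [->|an0] := eqVneq (Normc.normc a) 0.
  rewrite mul0r; have [x [v vr _]] := wDmods_neq0 f.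
  exact: le_trans (wDmod_ge0 (a *: f) v) (wDmod_le (lipP (a *: f)) vr).
have {an0}a0 : 0 < Normc.normc a by rewrite lt_neqAle eq_sym an0.
rewrite -ler_pdivlMl//; apply: ge_sup => [|_ [v vr <-]].
  exact: wDmods_neq0.
rewrite ler_pdivlMl// -wDmodZ; exact: (wDmod_le (lipP (a *: f))).
Qed.

Lemma lip_norm0_eq0 f : lip_norm f = 0 -> f = 0.
Proof.
move=> [fn0]; have f0 : Normc.normc (f root) = 0 /\ sup (wDmods f) = 0.
  have [v vr] : exists v : T, v != root.
    by have [_ [v vr _]] := wDmods_neq0 f; exists v.
  have s0 := le_trans (wDmod_ge0 f v) (wDmod_le (lipP f) vr).
  by move/eqP: fn0; rewrite paddr_eq0 ?normc_ge0// => /andP[/eqP ? /eqP ?].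
apply/val_inj/funext => v /=; move: {2}(depth v) (erefl (depth v)) => n.
elim/ltn_ind: n v => n IH v vn.
have [->|vr] := eqVneq v root; first exact: Normc.eq0_normc f0.1.
have := IH (depth (parent v)); rewrite -vn => /(_ (depth_parent_lt vr) _ erefl) p0.
have : wDmod f v <= 0 by rewrite -f0.2; exact: wDmod_le.
rewrite /wDmod pmulr_rle0 ?ltr0n ?depth_gt0// => h.
apply: Normc.eq0_normc; apply/eqP; rewrite eq_le normc_ge0 andbT.
by move: h; rewrite /Dmod p0 subr0.
Qed.

HB.instance Definition _ := @Lmodule_isNormed.Build R[i] (lip R T k)
  lip_norm lip_normD lip_normZ lip_norm0_eq0.

End lip_norm.


Section operators.
Variables (R : realType) (V : normedModType R[i]).
Implicit Types S : V -> V.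

(* Norms of V are real elements of R[i], hence the real part. *)
Definition op_norm S : \bar R :=
  ereal_sup [set (complex.Re `|S x|)%:E | x in [set x : V | `|x| <= 1]].

Definition bounded_op S : Prop := linear S /\ (op_norm S < +oo)%E.

Definition compact_op S : Prop :=
  linear S /\ precompact (S @` [set x : V | `|x| <= 1]).

Definition ess_norm S : \bar R :=
  ereal_inf [set op_norm (fun x => S x - K x) | K in [set K | compact_op K]].

End operators.

Section multiplication.
Variables (R : realType) (T : tree) (k : lip_kind).
Implicit Types psi : T -> R[i].

(* M_psi on the space k; the default 0 is used only when psi f leaves it,
   which [mulop_bounded] excludes. *)
Definition mulop psi (f : lip R T k) : lip R T k :=
  insubd 0 (fun v => psi v * f v).

Definition mulop_bounded psi : Prop :=
  (forall f : lip R T k, in_lip k (fun v => psi v * f v)) /\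
  bounded_op (mulop psi).

End multiplication.
Arguments mulop {R T} k psi f.
Arguments mulop_bounded {R T} k psi.

Section symbols.
Variables (R : realType) (T : tree).
Implicit Types psi : T -> R[i].

Definition A_lim psi : \bar R :=
  limn (fun n => ereal_sup
    [set (Normc.normc (psi v))%:E | v in [set v : T | (n <= depth v)%N]]).

Definition B_lim psi : \bar R :=
  limn (fun n => ereal_sup
    [set ((depth v)%:R * ln (depth v)%:R * Dmod psi v)%:E
      | v in [set v : T | v != root /\ (n <= depth v)%N]]).

End symbols.

(* Main.v *)
(* Let f_n agree with f on the ball of radius n and be constant on each subtree
   hanging from the sphere of radius n. The operator f |-> psi f_n has finite
   rank, hence is compact. With g = f - f_n one has g = 0 on the ball, Dg = Df
   outside it, and |g(v)| <= |f|_w (1/(n+1) + ... + 1/|v|) <= |f|_w log |v|, so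
   the Leibniz rule bounds |psi g|_w by |f|_w times the sum of the tail suprema
   of |psi| and of |v| log|v| Dpsi.
   The equivalence of boundedness on the two spaces rests on the same
   truncation: D(psi f) at v only sees f_n for n = |v|; conversely psi (f - f_n)
   tends to 0 in norm, and psi f_n vanishes at infinity provided |v| Dpsi(v)
   does. The latter is obtained by testing M_psi on v |-> 1 + 1/2 + ... + 1/|v|,
   which is extremal for point evaluations and unbounded. *)
Require Import Defs.
From HB Require Import structures.
From mathcomp Require Import all_boot all_order all_algebra.
From mathcomp Require Import complex.
From mathcomp Require Import all_classical all_reals all_analysis.
From mathcomp Require Import ring.
Set Implicit Arguments.
Unset Strict Implicit.
Unset Printing Implicit Defensive.
Import Order.TTheory GRing.Theory Num.Theory.
Import numFieldNormedType.Exports.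

Local Open Scope classical_set_scope.
Local Open Scope ring_scope.
Local Open Scope complex_scope.

Local Notation root := Defs.root.
Local Notation mulf psi f := (fun v => psi v * f v).

(** * Depth, parents and ancestors in the rooted tree *)

Section tree_geometry.
Variable T : tree.
Implicit Types v w : T.

(** Appending [w] to the root path of [v] gives a walk to [w], and extracting a simple path from a
    walk cannot lengthen it. *)
Lemma depth_adj_le v w : adj v w -> (depth w <= (depth v).+1)%N.
Proof.
move=> vw; have [pp lp _] := root_pathP v.
have : path (@adj T) root (rcons (root_path v) w) by rewrite rcons_path pp lp.
have : last root (rcons (root_path v) w) = w by rewrite last_rcons.
move=> + rp; case/shortenP: rp => q qp qu sub lq.
rewrite (depth_path qp lq qu) /depth -(size_rcons _ w).
by apply: uniq_leq_size sub; case/andP: qu.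
Qed.

Lemma depth_parent v : v != root -> depth v = (depth (parent v)).+1.
Proof.
move=> vr; apply/eqP; rewrite eqn_leq depth_parent_lt// andbT.
by apply: depth_adj_le; rewrite adj_sym; case: (parentP vr).
Qed.

Lemma depth_eq0 v : (depth v == 0%N) = (v == root).
Proof.
have [->|/depth_gt0] := eqVneq v root; first by rewrite depth_root.
by rewrite lt0n => /negbTE.
Qed.

(** A non-root vertex of depth at most n+1 is a neighbor of its parent, which lies in the ball of
    radius n; local finiteness then drives the induction. *)
Lemma finite_ball n : finite_set [set v : T | (depth v <= n)%N].
Proof.
elim: n => [|n IH].
  apply: (@sub_finite_set _ _ [set root]); last exact: finite_set1.
  by move=> v /=; rewrite leqn0 depth_eq0 => /eqP.
apply: (@sub_finite_set _ _ ([set root] `|`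
    \bigcup_(u in [set v : T | (depth v <= n)%N]) [set w | adj u w])).
  move=> v /= vn; have [->|vr] := eqVneq v root; [by left|right].
  exists (parent v); first by rewrite /= -ltnS -depth_parent.
  by rewrite /= adj_sym; case: (parentP vr).
rewrite finite_setU; split; first exact: finite_set1.
by apply: bigcup_finite => // u _; exact: adj_locally_finite.
Qed.

Lemma exists_deep n : exists v : T, (n < depth v)%N.
Proof.
apply: contrapT => no; apply: (tree_infinite (t := T)).
apply: sub_finite_set (finite_ball n) => v _ /=.
by rewrite leqNgt; apply/negP => nv; apply: no; exists v.
Qed.

(* The ancestor of v at depth n; v itself when |v| <= n (truncated subtraction). *)
Definition anc n v : T := iter (depth v - n) (@parent T) v.

Lemma anc_id n v : (depth v <= n)%N -> anc n v = v.
Proof. by rewrite /anc -subn_eq0 => /eqP ->. Qed.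

Lemma gt_depth_neq_root n v : (n < depth v)%N -> v != root.
Proof. by move=> nv; rewrite -depth_eq0 -lt0n; exact: leq_trans nv. Qed.

Lemma anc_parent n v : (n < depth v)%N -> anc n (parent v) = anc n v.
Proof.
move=> nv; have dv := depth_parent (gt_depth_neq_root nv).
by rewrite /anc dv subSn -?iterSr// -ltnS -dv.
Qed.

Lemma depth_anc n v : (depth (anc n v) <= n)%N.
Proof.
move: {2}(depth v) (erefl (depth v)) => m.
elim: m v => [|m IH] v vm; first by rewrite anc_id ?vm.
have [vn|nv] := leqP (depth v) n; first by rewrite anc_id.
rewrite -anc_parent//; apply: IH; apply: succn_inj.
by rewrite -depth_parent ?(gt_depth_neq_root nv).
Qed.

Lemma anc_root n : anc n root = root.
Proof. by rewrite anc_id// depth_root. Qed.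

Lemma anc0 v : anc 0 v = root.
Proof. by apply/eqP; rewrite -depth_eq0 -leqn0 depth_anc. Qed.

Lemma depth_parent_le v : (depth (parent v) <= depth v)%N.
Proof.
have [->|vr] := eqVneq v root; first by rewrite parent_root.
by rewrite (depth_parent vr).
Qed.

End tree_geometry.

(** * Harmonic sums, truncation and growth of Lipschitz functions *)

Section growth.
Variables (R : realType) (T : tree).
Implicit Types f g psi : T -> R[i].

Definition trunc n f : T -> R[i] := fun v => f (anc n v).

(** [series] sums over indices below n and [harmonic i] is 1/(i+1), so [H n] is 1 + ... + 1/n and
    [H 0] is 0. *)
Local Notation H := (series (@harmonic R)).

Lemma harmonic_sumS n : H n.+1 = H n + n.+1%:R^-1.
Proof. by rewrite seriesEnat/= big_nat_recr. Qed.

Lemma harmonic_sum0 : H 0%N = 0.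
Proof. by rewrite seriesEnat/= big_geq. Qed.

Lemma harmonic_sum_ge0 n : 0 <= H n.
Proof. by rewrite seriesEnat; apply: sumr_ge0 => i _; exact: harmonic_ge0. Qed.

Lemma harmonic_sum_ge1 n : (0 < n)%N -> 1 <= H n.
Proof.
case: n => // n _; elim: n => [|n IH].
  by rewrite harmonic_sumS harmonic_sum0 add0r invr1.
by rewrite harmonic_sumS (le_trans IH)// lerDl invr_ge0.
Qed.

Lemma harmonic_sum_le m n : (m <= n)%N -> H m <= H n.
Proof.
move: m n; apply/nondecreasing_seqP => n.
by rewrite harmonic_sumS lerDl invr_ge0.
Qed.

Lemma harmonic_sum_unbounded (M : R) :
  exists N, forall n, (N <= n)%N -> M <= H n.
Proof.
have /cvgryPge /(_ M) [N _ HN] := nondecreasing_dvgn_lt harmonic_sum_le (@dvg_harmonic R).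
by exists N => n /HN.
Qed.

(** This is ln (1 + x) <= x at x = -1/(n+1). *)
Lemma inv_le_ln_diff n : (0 < n)%N ->
  n.+1%:R^-1 <= ln n.+1%:R - ln n%:R :> R.
Proof.
move=> n0; have nR : 0 < n%:R :> R by rewrite ltr0n.
have SnR : 0 < n.+1%:R :> R by rewrite ltr0n.
rewrite -lerN2 opprB -ln_div ?posrE//.
have -> : n%:R / n.+1%:R = 1 + - n.+1%:R^-1 :> R.
  rewrite -[n%:R](addrK 1) natr1 mulrBl mul1r divff// gt_eqF//.
apply: le_ln1Dx; rewrite ltrN2 invf_lt1// ltr1n.
by [].
Qed.

(** The previous bound telescopes; this is where the logarithm in B comes from. Positivity of [m]
    matters: the term 1 separating [H 0] from [H 1] has no logarithm to absorb it. *)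
Lemma harmonic_sum_ln m n : (0 < m)%N -> (m <= n)%N ->
  H n - H m <= ln n%:R - ln m%:R.
Proof.
move=> m0; elim: n => [|n IH]; first by move: m0; case: m.
rewrite leq_eqVlt => /predU1P[->|]; first by rewrite !subrr.
rewrite ltnS => mn; have n0 := leq_trans m0 mn.
rewrite harmonic_sumS addrAC.
apply: (le_trans (lerD (IH mn) (inv_le_ln_diff n0))).
by rewrite addrC subrKA.
Qed.

Lemma Dmod_root f : Dmod f root = 0.
Proof. by rewrite /Dmod parent_root subrr Normc.normc0. Qed.

Lemma wDmod_root f : wDmod f root = 0.
Proof. by rewrite /wDmod Dmod_root mulr0. Qed.

Lemma normc_real (r : R) : Normc.normc r%:C = `|r|.
Proof. by rewrite /= expr0n addr0 sqrtr_sqr. Qed.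

Lemma normc_triangle (a b c : R[i]) :
  Normc.normc (a - c) <= Normc.normc (a - b) + Normc.normc (b - c).
Proof. by rewrite -[a - c](subrKA b); exact: le_normcD. Qed.

(* Summing Df(w) <= M / |w| along the path from anc n v to v. *)
Lemma growth f (M : R) n v :
  (forall w, wDmod f w <= M) -> (n <= depth v)%N ->
  Normc.normc (f v - f (anc n v)) <= M * (H (depth v) - H n).
Proof.
move=> fM; move: {2}(depth v) (erefl (depth v)) => m.
elim: m v => [|m IH] v vm.
  rewrite vm leqn0 => /eqP ->.
  by rewrite anc_id ?vm// !subrr Normc.normc0 mulr0.
rewrite leq_eqVlt => /predU1P[->|nv].
  by rewrite anc_id// !subrr Normc.normc0 mulr0.
have vr := gt_depth_neq_root nv; have dv := depth_parent vr.
have pm : depth (parent v) = m by apply: succn_inj; rewrite -dv.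
apply: (le_trans (normc_triangle _ (f (parent v)) _)).
rewrite vm harmonic_sumS addrAC [X in _ <= M * X]addrC mulrDr; apply: lerD.
  rewrite ler_pdivlMr ?ltr0n// mulrC -vm; exact: fM.
rewrite -(anc_parent nv) -pm; apply: IH => //; rewrite -ltnS -dv//.
Qed.

Lemma wDmod_trunc_le n f v : (depth v <= n)%N -> wDmod (trunc n f) v = wDmod f v.
Proof.
move=> vn; rewrite /wDmod /Dmod /trunc !anc_id//.
exact: leq_trans (depth_parent_le v) vn.
Qed.

Lemma wDmod_trunc_gt n f v : (n < depth v)%N -> wDmod (trunc n f) v = 0.
Proof.
by move=> nv; rewrite /wDmod /Dmod /trunc anc_parent// subrr Normc.normc0 mulr0.
Qed.

Lemma wDmod_trunc n f v : wDmod (trunc n f) v <= wDmod f v.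
Proof.
have [vn|nv] := leqP (depth v) n; first by rewrite wDmod_trunc_le.
by rewrite wDmod_trunc_gt// wDmod_ge0.
Qed.

(** The Leibniz rule is split asymmetrically, with [psi] taken at [v] and [g] at its parent, so the
    sum has two terms only. *)
Lemma wDmodM psi g v :
  wDmod (fun w => psi w * g w) v <=
    Normc.normc (psi v) * wDmod g v + Normc.normc (g (parent v)) * wDmod psi v.
Proof.
rewrite /wDmod mulrCA [X in _ <= _ + X]mulrCA -mulrDr ler_wpM2l// /Dmod.
rewrite -!Normc.normcM.
have -> : psi v * g v - psi (parent v) * g (parent v) =
  psi v * (g v - g (parent v)) + g (parent v) * (psi v - psi (parent v)).
  by ring.
exact: le_normcD.
Qed.

Lemma in_lip_wDmod f M k : (forall v, wDmod f v <= M) ->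
  (k = Lw0 -> wvanish f) -> in_lip k f.
Proof.
move=> fM fk; split; last by case: k fk => // /(_ erefl).
by exists M => _ [v _ <-]; exact: fM.
Qed.

Lemma wDmod_le_sup k f v : in_lip k f -> wDmod f v <= sup (wDmods f).
Proof.
move=> fk; have [->|] := eqVneq v root; last exact: (wDmod_le fk).
rewrite wDmod_root; have [_ [w wr _]] := wDmods_neq0 f.
exact: le_trans (wDmod_ge0 f w) (wDmod_le fk wr).
Qed.

Lemma wDmod_le_wnorm k f v : in_lip k f -> wDmod f v <= wnorm f.
Proof.
by move=> fk; rewrite (le_trans (wDmod_le_sup v fk))// lerDr normc_ge0.
Qed.

Lemma root_le_wnorm k f : in_lip k f -> Normc.normc (f root) <= wnorm f.
Proof.
move=> fk; rewrite lerDl; apply: le_trans (wDmod_le_sup root fk).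
exact: wDmod_ge0.
Qed.

Lemma wnorm_ge0 k f : in_lip k f -> 0 <= wnorm f.
Proof. by move=> /root_le_wnorm; exact/le_trans/normc_ge0. Qed.

Lemma wnorm_le f M : (forall v, v != root -> wDmod f v <= M) ->
  wnorm f <= Normc.normc (f root) + M.
Proof.
move=> fM; rewrite lerD2l; apply: ge_sup; first exact: wDmods_neq0.
by move=> _ [v vr <-]; exact: fM.
Qed.

Lemma in_lip_Lw k f : in_lip k f -> in_lip Lw f.
Proof. by case. Qed.

Lemma in_lipB k f g : in_lip k f -> in_lip k g -> in_lip k (f - g).
Proof.
move=> fk gk; have [_ cl] := lip_submod_closed R T k.
have /asboolP := cl (-1) g f (asboolT gk) (asboolT fk).
by rewrite scaleN1r addrC.
Qed.

(** Truncation carries even L_w into L_{w,0}, since the truncated function has no variation beyond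
    depth n. *)
Lemma in_lip_trunc k n f : in_lip Lw f -> in_lip k (trunc n f).
Proof.
move=> fk; apply: (@in_lip_wDmod _ (wnorm f)).
  by move=> v; apply: le_trans (wDmod_trunc _ _ _) (wDmod_le_wnorm _ fk).
move=> _ e e0; exists n.+1 => v nv; by rewrite wDmod_trunc_gt.
Qed.

Lemma wnorm_trunc n f : in_lip Lw f -> wnorm (trunc n f) <= wnorm f.
Proof.
move=> fk; rewrite [leRHS]/wnorm.
have <- : Normc.normc (trunc n f root) = Normc.normc (f root).
  by rewrite /trunc anc_root.
apply: wnorm_le => v vr; apply: le_trans (wDmod_trunc _ _ _) _.
exact: wDmod_le fk vr.
Qed.

(** Growth from the root, where |f(o)| is absorbed because [H (depth v)] is at least 1 away from the
    root. *)
Lemma normc_le_wnorm k f v : in_lip k f -> v != root ->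
  Normc.normc (f v) <= H (depth v) * wnorm f.
Proof.
move=> fk vr; have := growth (fun w => wDmod_le_sup w fk) (leq0n (depth v)).
rewrite anc0 harmonic_sum0 subr0 => g.
have H1 := harmonic_sum_ge1 (depth_gt0 vr).
have := normc_triangle (f v) (f root) 0; rewrite !subr0 => /le_trans; apply.
rewrite /wnorm mulrDr addrC; apply: lerD; last by rewrite mulrC.
by rewrite ler_peMl ?normc_ge0.
Qed.

End growth.

(** * Operator bounds and compactness in complex normed spaces *)

Section normed_complex.
Variables (R : realType) (V : normedModType R[i]).
Implicit Types (S : V -> V) (x : V).

Lemma ge0_Re (z : R[i]) : 0 <= z -> z = (complex.Re z)%:C.
Proof. by case: z => a b; rewrite lecE => /andP[/= /eqP -> _]. Qed.

Lemma norm_Re x : `|x| = (complex.Re `|x|)%:C.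
Proof. by rewrite -ge0_Re. Qed.

Lemma Re_norm_ge0 x : 0 <= complex.Re `|x|.
Proof. by rewrite -lecR -norm_Re normr_ge0. Qed.

Lemma norm_le1 x : (`|x| <= 1) = (complex.Re `|x| <= 1).
Proof. by rewrite norm_Re -[1]/(1%:C) lecR. Qed.

Lemma Re_normZ (r : R) x : 0 <= r ->
  complex.Re `|r%:C *: x| = r * complex.Re `|x|.
Proof.
move=> r0; have rC : 0 <= r%:C :> R[i] by rewrite lecR.
by rewrite normrZ ger0_norm// {1}norm_Re -rmorphM.
Qed.

Lemma op_norm_le S (M : \bar R) :
  (forall x, complex.Re `|x| <= 1 -> ((complex.Re `|S x|)%:E <= M)%E) ->
  (op_norm S <= M)%E.
Proof. by move=> SM; apply: ge_ereal_sup => _ [x /= + <-]; rewrite norm_le1 => /SM. Qed.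

Lemma op_norm_bound S : linear S -> (op_norm S < +oo)%E ->
  exists2 C : R, 0 <= C &
    forall x, complex.Re `|S x| <= C * complex.Re `|x|.
Proof.
move=> Slin Sfin.
have S0 : S 0 = 0.
  by have := Slin (-1) 0 0; rewrite scaler0 addr0 scaleN1r addNr.
have SZ a x : S (a *: x) = a *: S x.
  by have := Slin a x 0; rewrite S0 !addr0.
have Sub x : `|x| <= 1 -> ((complex.Re `|S x|)%:E <= op_norm S)%E.
  by move=> x1; apply: ereal_sup_ubound; exists x.
have op0 : (0 <= op_norm S)%E.
  by apply: le_trans (Sub 0 _); rewrite ?normr0// lee_fin Re_norm_ge0.
have fS : op_norm S \is a fin_num by rewrite ge0_fin_numE.
exists (fine (op_norm S)); first exact: fine_ge0.
move=> x; have [->|x0] := eqVneq x 0.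
  by rewrite S0 !normr0 mulr0.
have nx : 0 < complex.Re `|x| by rewrite -ltcR -norm_Re normr_gt0.
have c0 : 0 <= (complex.Re `|x|)^-1 by rewrite invr_ge0 ltW.
have /Sub : `|(complex.Re `|x|)^-1%:C *: x| <= 1.
  by rewrite norm_le1 Re_normZ// mulVf// gt_eqF.
rewrite SZ Re_normZ//.
by rewrite -[op_norm S]fineK// lee_fin mulrC ler_pdivrMr.
Qed.

Lemma continuous_realZ x : continuous (fun r : R => r%:C *: x).
Proof.
move=> r; apply/cvgrPdist_lt => e e0.
have eRe := ge0_Re (ltW e0).
have e0' : 0 < complex.Re e by rewrite -ltcR -eRe.
have nx : 0 < complex.Re `|x| + 1 by rewrite ltr_wpDl ?Re_norm_ge0.
have d0 : 0 < complex.Re e / (complex.Re `|x| + 1) by rewrite divr_gt0.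
apply/nbhs_ballP; exists (complex.Re e / (complex.Re `|x| + 1)) => //= s rs.
rewrite /ball/= in rs.
rewrite -scalerBl -rmorphB/= normrZ [`|x|]norm_Re.
have -> : `|(r - s)%:C| = `|r - s|%:C :> R[i] by rewrite normc_def/= expr0n addr0 sqrtr_sqr.
rewrite -rmorphM/= eRe ltcR.
apply: (@le_lt_trans _ _ (`|r - s| * (complex.Re `|x| + 1))).
  by rewrite ler_wpM2l// lerDl.
by rewrite -ltr_pdivlMr.
Qed.

Lemma compact_sum (A B : set V) : compact A -> compact B ->
  compact [set z.1 + z.2 | z in A `*` B].
Proof.
move=> cA cB; apply: continuous_compact (compact_setX cA cB).
by apply: continuous_subspaceT => z; exact: add_continuous.
Qed.

(** The disk of radius M lies in the square where |Re a| and |Im a| are at most M, whose image is a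
    sum of two real segments, along x and along ix. *)
Lemma compact_disk_line x (M : R) : exists2 C : set V, compact C &
  forall a : R[i], Normc.normc a <= M -> C (a *: x).
Proof.
pose L (y : V) := [set r%:C *: y | r in `[- M, M]].
have cL y : compact (L y).
  apply: continuous_compact; last exact: segment_compact.
  by apply: continuous_subspaceT; exact: continuous_realZ.
exists [set z.1 + z.2 | z in L x `*` L ('i *: x)]; first exact: compact_sum.
move=> a aM.
have aRe : `|complex.Re a| <= M.
  by apply: le_trans aM; rewrite -lecR; exact: normc_ge_Re.
have aIm : `|complex.Im a| <= M.
  apply: le_trans aM; case: (a) => u w /=.
  by rewrite -sqrtr_sqr ler_wsqrtr// lerDr sqr_ge0.
exists ((complex.Re a)%:C *: x, (complex.Im a)%:C *: ('i *: x)); last first.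
  by rewrite /= scalerA -scalerDl mulrC -complexE.
split; [exists (complex.Re a) => //|exists (complex.Im a) => //];
  by rewrite /= in_itv /= -ler_norml.
Qed.

(** Each index contributes the compact set of the previous lemma, and sums of compact sets are
    compact. *)
Lemma compact_finite_span (I : eqType) (s : seq I) (h : I -> V) (M : I -> R) :
  exists2 C : set V, compact C &
    forall a : I -> R[i], (forall i, i \in s -> Normc.normc (a i) <= M i) ->
      C (\sum_(i <- s) a i *: h i).
Proof.
elim: s => [|i s [C cC CP]].
  exists [set 0]; first exact: compact_set1.
  by move=> a _; rewrite big_nil.
have [D cD DP] := compact_disk_line (h i) (M i).
exists [set z.1 + z.2 | z in D `*` C]; first exact: compact_sum.
move=> a aM; rewrite big_cons.
exists (a i *: h i, \sum_(j <- s) a j *: h j) => //; split.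
  by apply: DP; apply: aM; rewrite mem_head.
by apply: CP => j js; apply: aM; rewrite inE js orbT.
Qed.

(** Coefficients bounded on the unit ball confine its image to a compact set, and subsets of a
    compact set are precompact. *)
Lemma compact_op_finite_rank (I : eqType) (s : seq I) (K : V -> V)
    (a : I -> V -> R[i]) (h : I -> V) (M : I -> R) :
  linear K -> (forall x, K x = \sum_(i <- s) a i x *: h i) ->
  (forall i x, complex.Re `|x| <= 1 -> Normc.normc (a i x) <= M i) ->
  compact_op K.
Proof.
move=> Klin KE aM; split => //.
have [C cC CP] := compact_finite_span s h M.
apply: precompact_subset (compact_precompact (@norm_hausdorff _ V) cC).
move=> _ [x /= + <-]; rewrite norm_le1 KE => x1.
by apply: (CP (a^~ x)) => i _; exact: aM.
Qed.

End normed_complex.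

(** * Boundedness of M_psi as an inequality between functions *)

Section multiplication_bounds.
Variables (R : realType) (T : tree).
Implicit Types (f g psi : T -> R[i]) (k : lip_kind).

Local Notation H := (series (@harmonic R)).
Lemma lip_in k (f : lip R T k) : in_lip k f.
Proof. by apply/asboolP; exact: lip_funP. Qed.

Lemma Re_lip_norm k (f : lip R T k) : complex.Re `|f| = wnorm f.
Proof. by []. Qed.

Lemma mulopE k psi (f : lip R T k) :
  in_lip k (mulf psi f) -> mulop k psi f = mulf psi f :> (T -> R[i]).
Proof. by move=> pf; rewrite /mulop -[LHS]/(\val _) insubdK//; apply/asboolP. Qed.

Lemma lip_linE k a (f g : lip R T k) v : (a *: f + g) v = a * f v + g v.
Proof. by []. Qed.

Lemma mulop_linear k psi : (forall f : lip R T k, in_lip k (mulf psi f)) ->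
  linear (mulop k psi).
Proof.
move=> pin a f g; apply/val_inj/funext => v.
change (mulop k psi (a *: f + g) v = a * mulop k psi f v + mulop k psi g v).
by rewrite !mulopE// lip_linE; ring.
Qed.

(** Restates boundedness on plain functions, so that truncations and test functions can be inserted
    without packing them into [lip]. *)
Lemma mulop_boundedP k psi : mulop_bounded k psi <->
  exists2 C : R, 0 <= C & forall f, in_lip k f ->
    in_lip k (mulf psi f) /\ wnorm (mulf psi f) <= C * wnorm f.
Proof.
split=> [[pin [plin pfin]]|[C C0 CP]].
  have [C C0 CP] := op_norm_bound plin pfin; exists C => // f fk.
  have fl : f \in @lip_pred R T k by apply/asboolP.
  split; first exact: (pin (Lip fl)).
  by have := CP (Lip fl); rewrite !Re_lip_norm mulopE//=; exact: (pin (Lip fl)).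
have pin (f : lip R T k) : in_lip k (mulf psi f).
  by case: (CP f (lip_in f)).
split=> //; split; first exact: mulop_linear.
apply: (@le_lt_trans _ _ C%:E); last exact: ltry.
apply: op_norm_le => f; rewrite !Re_lip_norm mulopE// lee_fin => f1.
have [_ /le_trans] := CP f (lip_in f); apply.
by rewrite ler_piMr.
Qed.

End multiplication_bounds.

(** * Equivalence of boundedness on the two spaces *)

Section equivalence.
Variables (R : realType) (T : tree).
Implicit Types (f g psi : T -> R[i]) (k : lip_kind).

Local Notation H := (series (@harmonic R)).
Lemma mulop_bounded_Lw0_Lw psi : mulop_bounded Lw0 psi -> mulop_bounded Lw psi.
Proof.
move=> /mulop_boundedP[C C0 CP]; apply/mulop_boundedP.
(* The first summand controls the value of psi f at the root, the second its weighted
   differences. *)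
exists (Normc.normc (psi root) + C) => [|f fk].
  by rewrite addr_ge0 ?normc_ge0.
have le v : wDmod (mulf psi f) v <= C * wnorm f.
  have [tk tn] := CP _ (in_lip_trunc Lw0 (depth v) fk).
  have -> : wDmod (mulf psi f) v = wDmod (mulf psi (trunc (depth v) f)) v.
    by rewrite /wDmod /Dmod /trunc !anc_id ?depth_parent_le.
  apply: le_trans (wDmod_le_wnorm v tk) (le_trans tn _).
  by rewrite ler_wpM2l// wnorm_trunc.
split; first exact: in_lip_wDmod le _.
apply: (le_trans (wnorm_le (fun v _ => le v))).
rewrite Normc.normcM mulrDl lerD2r ler_wpM2l ?normc_ge0//.
exact: root_le_wnorm fk.
Qed.

(* The extremal function for point evaluations: |h|_w <= 1 and
   |f(v)| <= h(v) |f|_w for all f and all v != root. *)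
Definition harmonic_depth : T -> R[i] := fun v => (H (depth v))%:C.

Lemma wDmod_harmonic_depth v : wDmod harmonic_depth v <= 1.
Proof.
have [->|vr] := eqVneq v root; first by rewrite wDmod_root.
rewrite /wDmod /Dmod /harmonic_depth (depth_parent vr) harmonic_sumS.
rewrite -rmorphB normc_real addrAC subrr add0r.
by rewrite ger0_norm ?invr_ge0// divff.
Qed.

Lemma harmonic_depth_Lw : in_lip Lw harmonic_depth.
Proof. exact: in_lip_wDmod wDmod_harmonic_depth _. Qed.

Lemma normc_harmonic_depth v : Normc.normc (harmonic_depth v) = H (depth v).
Proof.
by rewrite /harmonic_depth normc_real ger0_norm ?harmonic_sum_ge0.
Qed.

Lemma wnorm_harmonic_depth : wnorm harmonic_depth <= 1.
Proof.
apply: le_trans (wnorm_le (fun v _ => wDmod_harmonic_depth v)) _.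
by rewrite normc_harmonic_depth depth_root harmonic_sum0 add0r.
Qed.

(** With h the harmonic test function, evaluating psi h at v gives a factor H(|v|) on both sides, so
    psi is bounded. The Leibniz rule then bounds H(|v|) |v| Dpsi(v), and H is unbounded. *)
Lemma mulop_bounded_wvanish psi : mulop_bounded Lw psi -> wvanish psi.
Proof.
move=> /mulop_boundedP[C C0 /(_ _ harmonic_depth_Lw)[pk pC]].
have {}pC : wnorm (mulf psi harmonic_depth) <= C.
  by apply: le_trans pC _; rewrite ler_piMr// wnorm_harmonic_depth.
(* [C] bounds psi off the root; at the root h vanishes, so the value of psi there is added by
   hand. *)
pose P := C + Normc.normc (psi root).
have P0 : 0 <= P by rewrite addr_ge0 ?normc_ge0.
have psiP v : Normc.normc (psi v) <= P.
  have [->|vr] := eqVneq v root; first by rewrite lerDr.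
  have H0 : 0 < H (depth v).
    exact: lt_le_trans ltr01 (harmonic_sum_ge1 R (depth_gt0 vr)).
  apply: (@le_trans _ _ C); last by rewrite lerDl normc_ge0.
  rewrite -(ler_pM2l H0).
  apply: (@le_trans _ _ (H (depth v) * wnorm (mulf psi harmonic_depth))).
    have := normc_le_wnorm pk vr.
    by rewrite Normc.normcM normc_harmonic_depth mulrC.
  by rewrite ler_wpM2l// ltW.
have HD v : H (depth v) * wDmod psi v <= C + P.
  rewrite -normc_harmonic_depth /wDmod mulrCA -Normc.normcM.
  (* The Leibniz identity solved for the term with the difference of psi. *)
  have -> : harmonic_depth v * (psi v - psi (parent v)) =
      (psi v * harmonic_depth v - psi (parent v) * harmonic_depth (parent v)) -
      psi (parent v) * (harmonic_depth v - harmonic_depth (parent v)).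
    by ring.
  apply: (@le_trans _ _ (wDmod (mulf psi harmonic_depth) v +
      Normc.normc (psi (parent v)) * wDmod harmonic_depth v)).
    rewrite /wDmod mulrCA -mulrDr ler_wpM2l// /Dmod -Normc.normcM.
    by rewrite -[X in _ <= _ + X]normcN; exact: le_normcD.
  apply: lerD; first exact: le_trans (wDmod_le_wnorm v pk) pC.
  rewrite -[P]mulr1 ler_pM ?normc_ge0 ?wDmod_ge0//.
  exact: wDmod_harmonic_depth.
(* The extra 1 makes the final inequality strict. *)
move=> e e0; have [N HN] := harmonic_sum_unbounded ((C + P + 1) / e).
exists N => v /HN; rewrite ler_pdivrMr// => HNv.
have H0 : 0 < H (depth v).
  by rewrite -(pmulr_lgt0 _ e0) (lt_le_trans _ HNv)// ltr_wpDl// addr_ge0.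
rewrite -(ltr_pM2l H0); apply: le_lt_trans (HD v) (lt_le_trans _ HNv).
by rewrite ltrDl.
Qed.

Lemma mulop_bounded_Lw_Lw0 psi : mulop_bounded Lw psi -> mulop_bounded Lw0 psi.
Proof.
move=> bpsi; have psi0 := mulop_bounded_wvanish bpsi.
move: bpsi => /mulop_boundedP[C C0 CP]; apply/mulop_boundedP.
exists C => // f f0; have fk := in_lip_Lw f0.
have [pk pC] := CP f fk; split=> //; split; first by case: pk.
move=> e e0; have e2 : 0 < e / 2 by rewrite divr_gt0.
have C1 : 0 < C + 1 by rewrite ltr_wpDl.
(* This threshold will bound the norm of f minus its truncation at n; applying M_psi then gives at
   most e/2. The 1 in [C + 1] keeps the divisor positive. *)
have [n fn] := f0.2 _ (divr_gt0 e2 C1).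
(* The truncation takes only values of f on the ball of radius n: the first summand bounds them off
   the root, the second at the root. *)
pose M := H n * wnorm f + wnorm f.
have M0 : 0 <= M.
  by rewrite addr_ge0 ?mulr_ge0 ?harmonic_sum_ge0 ?(wnorm_ge0 fk).
have M1 : 0 < M + 1 by rewrite ltr_wpDl.
have tM v : Normc.normc (trunc n f v) <= M.
  rewrite /trunc; have [->|vr] := eqVneq (anc n v) root.
    apply: le_trans (root_le_wnorm fk) _.
    by rewrite lerDr mulr_ge0 ?harmonic_sum_ge0 ?(wnorm_ge0 fk).
  apply: le_trans (normc_le_wnorm fk vr) _.
  apply: (@le_trans _ _ (H n * wnorm f)); last by rewrite lerDl (wnorm_ge0 fk).
  by rewrite ler_wpM2r ?(wnorm_ge0 fk)// harmonic_sum_le// depth_anc.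
have [m psim] := psi0 _ (divr_gt0 e2 M1).
(* Depth beyond n removes the variation of the truncation, leaving only its values times Dpsi; depth
   at least m makes that product small. *)
exists (maxn n.+1 m) => v; rewrite geq_max => /andP[nv mv].
pose g := f - trunc n f.
have gk : in_lip Lw g by apply: in_lipB => //; exact: in_lip_trunc.
have gn : wnorm g <= e / 2 / (C + 1).
  have -> : e / 2 / (C + 1) = Normc.normc (g root) + e / 2 / (C + 1).
    by rewrite /g !fctE /trunc anc_root subrr Normc.normc0 add0r.
  apply: wnorm_le => w wr; have [wn|nw] := leqP (depth w) n.
    have -> : wDmod g w = 0; last by rewrite ltW// divr_gt0.
    rewrite /wDmod /Dmod /g !fctE /trunc !anc_id ?subrr ?Normc.normc0 ?mulr0//.
    exact: leq_trans (depth_parent_le w) wn.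
  have -> : wDmod g w = wDmod f w; last by rewrite ltW// fn// ltnW.
  rewrite /wDmod /Dmod /g !fctE /trunc anc_parent//; congr (_ * Normc.normc _).
  by ring.
have [gpk gp] := CP g gk.
have -> : mulf psi f = mulf psi (trunc n f) + mulf psi g.
  by apply/funext => w; rewrite !fctE -mulrDr addrC subrK.
apply: le_lt_trans (wDmodD _ _ _) _; rewrite [ltRHS]splitr; apply: ltr_leD.
  apply: le_lt_trans (wDmodM _ _ _) _; rewrite wDmod_trunc_gt// mulr0 add0r.
  apply: (@le_lt_trans _ _ ((M + 1) * wDmod psi v)).
    by rewrite ler_wpM2r ?wDmod_ge0// (le_trans (tM _))// lerDl.
  by rewrite -ltr_pdivlMl// mulrC psim.
apply: le_trans (wDmod_le_wnorm v gpk) (le_trans gp _).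
apply: (@le_trans _ _ ((C + 1) * wnorm g)).
  by rewrite ler_wpM2r ?(wnorm_ge0 gk)// lerDl.
by rewrite -ler_pdivlMl// mulrC.
Qed.

End equivalence.

(** * Compactness of the truncated operator and the norm of the remainder *)

Section essential_norm.
Variables (R : realType) (T : tree) (k : lip_kind).
Implicit Types (f g psi : T -> R[i]).

Local Notation H := (series (@harmonic R)).
Definition lip_trunc n (f : lip R T k) : lip R T k :=
  Lip (asboolT (in_lip_trunc k n (in_lip_Lw (lip_in f)))).

Lemma lip_sumE (I : Type) (s : seq I) (F : I -> lip R T k) v :
  (\sum_(i <- s) F i) v = \sum_(i <- s) F i v.
Proof. by elim/big_rec2: _ => // i a b _ <-. Qed.

(** Serves to put truncated point indicators in the space: differences are at most 2M, and they
    vanish once |v| exceeds n. *)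
Lemma in_lip_trunc_bounded n f M :
  (forall v, Normc.normc (f v) <= M) -> in_lip k (trunc n f).
Proof.
move=> fM; have M0 : 0 <= M by apply: le_trans (fM root); exact: normc_ge0.
apply: (@in_lip_wDmod _ _ _ (n%:R * (M + M))) => [v|_ e e0]; last first.
  by exists n.+1 => v nv; rewrite wDmod_trunc_gt.
have [vn|nv] := leqP (depth v) n; last first.
  by rewrite wDmod_trunc_gt// mulr_ge0// addr_ge0.
rewrite wDmod_trunc_le// ler_pM ?normc_ge0 ?ler_nat//.
apply: le_trans (le_normcD _ _) _; rewrite normcN; exact: lerD.
Qed.

(* f o anc n depends only on the finitely many values of f on the ball of
   radius n. *)
Lemma compact_mulop_trunc psi n : mulop_bounded k psi ->
  compact_op (fun f : lip R T k => mulop k psi (lip_trunc n f)).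
Proof.
move=> [pin _].
have [s sE] := (finite_seqP _).1 (finite_ball T n).
pose I (v w : T) : R[i] := (w == v)%:R.
have I1 v w : Normc.normc (I v w) <= 1.
  by rewrite /I; case: eqP => _; rewrite ?Normc.normc1 ?Normc.normc0.
(* [e v] is the indicator of the vertices whose ancestor at depth n is [v]. The truncation of f is
   the sum of f(v) [e v] over the ball; point evaluations are the coefficients. *)
pose e v : lip R T k := Lip (asboolT (in_lip_trunc_bounded n (I1 v))).
apply: (@compact_op_finite_rank _ _ _ (undup s) _
  (fun v (x : lip R T k) => x v)
  (fun v => mulop k psi (e v)) (fun v => 1 + H (depth v))).
- move=> a f g; apply/val_inj/funext => v.
  change (mulop k psi (lip_trunc n (a *: f + g)) v =
    a * mulop k psi (lip_trunc n f) v + mulop k psi (lip_trunc n g) v).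
  rewrite !mulopE//; set w := anc n v.
  change (psi v * (a * f w + g w) = a * (psi v * f w) + psi v * g w); ring.
- move=> f; apply/val_inj/funext => v /=.
  rewrite lip_sumE (mulopE (pin _)) /= (bigD1_seq (anc n v)) ?undup_uniq//=; last first.
    rewrite mem_undup; have : [set` s] (anc n v) by rewrite -sE /= depth_anc.
    by [].
  rewrite [X in _ + X]big1 ?addr0 => [|u uv].
    change (psi v * trunc n f v = f (anc n v) * mulop k psi (e (anc n v)) v).
    by rewrite (mulopE (pin _)) /= /trunc /I eqxx mulr1 mulrC.
  change (f u * mulop k psi (e u) v = 0).
  by rewrite (mulopE (pin _)) /= /trunc /I eq_sym (negbTE uv) !mulr0.
- move=> v f; rewrite Re_lip_norm => f1.
  have fk := lip_in f; have H0 := harmonic_sum_ge0 R (depth v).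
  have [->|vr] := eqVneq v root.
    apply: le_trans (root_le_wnorm fk) (le_trans f1 _).
    by rewrite lerDl harmonic_sum_ge0.
  apply: le_trans (normc_le_wnorm fk vr) _.
  by rewrite (@le_trans _ _ (H (depth v)))// ?ler_piMr// lerDr.
Qed.

(** The remainder vanishes on the ball. Outside it, the two Leibniz terms are bounded by [a] and [b]
    respectively. *)
Lemma wnorm_mul_trunc_le psi f n (a b : R) : (0 < n)%N -> in_lip k f ->
  wnorm f <= 1 -> 0 <= a + b ->
  (forall v, (n <= depth v)%N -> Normc.normc (psi v) <= a) ->
  (forall v : T, v != root -> (n <= depth v)%N ->
    (depth v)%:R * ln (depth v)%:R * Dmod psi v <= b) ->
  wnorm (fun v => psi v * (f v - trunc n f v)) <= a + b.
Proof.
move=> n0 fk f1 ab0 psia psib.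
set g := fun v => f v - trunc n f v.
have gr : Normc.normc (psi root * g root) = 0.
  by rewrite /g /trunc anc_root subrr mulr0 Normc.normc0.
rewrite -[leRHS]add0r -gr; apply: (@wnorm_le _ _ (mulf psi g)) => v vr.
have [vn|nv] := leqP (depth v) n.
  rewrite /wDmod /Dmod /g /trunc !anc_id// ?(leq_trans (depth_parent_le v))//.
  by rewrite !subrr !mulr0 subrr Normc.normc0 mulr0.
have np : (n <= depth (parent v))%N by rewrite -ltnS -depth_parent.
have f1' w : wDmod f w <= 1 by apply: le_trans (wDmod_le_wnorm w fk) f1.
apply: le_trans (wDmodM _ _ _) _; apply: lerD.
  apply: le_trans (psia v (ltnW nv)); rewrite ler_piMr ?normc_ge0//.
  have -> : wDmod g v = wDmod f v => //.
  rewrite /wDmod /Dmod /g /trunc anc_parent//; congr (_ * Normc.normc _).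
  by ring.
apply: le_trans (psib v vr (ltnW nv)).
rewrite [_ * ln _]mulrC -mulrA ler_wpM2r ?wDmod_ge0//.
(* The remainder at the parent of v is the increment of f along the path from depth n, hence at most
   a difference of harmonic sums. *)
have := growth f1' np; rewrite mul1r => /le_trans; apply.
apply: le_trans (harmonic_sum_ln R n0 np) _.
have p0 := leq_trans n0 np.
apply: (@le_trans _ _ (ln (depth (parent v))%:R)).
  by rewrite gerBl ln_ge0// ler1n.
by rewrite ler_ln ?posrE ?ltr0n ?ler_nat ?depth_parent_le // depth_gt0.
Qed.

End essential_norm.

(** * Tail suprema and passage to the limit *)

Section main_estimate.
Variables (R : realType) (T : tree) (psi : T -> R[i]).

Definition A_tail n : \bar R :=
  ereal_sup [set (Normc.normc (psi v))%:E | v in [set v : T | (n <= depth v)%N]].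

Definition B_tail n : \bar R :=
  ereal_sup [set ((depth v)%:R * ln (depth v)%:R * Dmod psi v)%:E
    | v in [set v : T | v != root /\ (n <= depth v)%N]].

(** Rests on the existence of vertices of every depth: the supremum of an empty set would be -oo. *)
Lemma A_tail_ge0 n : (0 <= A_tail n)%E.
Proof.
have [v nv] := exists_deep T n.
apply: (@le_trans _ _ (Normc.normc (psi v))%:E); first by rewrite lee_fin normc_ge0.
by apply: ereal_sup_ubound; exists v => //=; exact: ltnW.
Qed.

Lemma B_tail_ge0 n : (0 <= B_tail n)%E.
Proof.
have [v nv] := exists_deep T n; have vr := gt_depth_neq_root nv.
apply: (@le_trans _ _ ((depth v)%:R * ln (depth v)%:R * Dmod psi v)%:E).
  by rewrite lee_fin !mulr_ge0 ?normc_ge0// ln_ge0// ler1n depth_gt0.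
by apply: ereal_sup_ubound; exists v => //=; split=> //; exact: ltnW.
Qed.

(** The tails are nonincreasing, hence converge in the extended reals, so the [limn] defining
    [A_lim] is a genuine limit. *)
Lemma A_tail_cvg : A_tail @ \oo --> A_lim psi.
Proof.
have nI : {homo A_tail : n m / (n <= m)%N >-> (m <= n)%E}.
  move=> n m nm; apply: ereal_sup_le => _ [v /= mv <-].
  by exists v => //=; exact: leq_trans mv.
exact: ereal_nonincreasing_is_cvgn nI.
Qed.

Lemma B_tail_cvg : B_tail @ \oo --> B_lim psi.
Proof.
have nI : {homo B_tail : n m / (n <= m)%N >-> (m <= n)%E}.
  move=> n m nm; apply: ereal_sup_le => _ [v /= [vr mv] <-].
  by exists v => //=; split=> //; exact: leq_trans mv.
exact: ereal_nonincreasing_is_cvgn nI.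
Qed.

Lemma ess_norm_mulop_le_tail (k : lip_kind) n : mulop_bounded k psi -> (0 < n)%N ->
  (ess_norm (mulop k psi) <= A_tail n + B_tail n)%E.
Proof.
move=> bk n0; have [pin _] := bk.
apply: (@le_trans _ _ (op_norm (fun f : lip R T k =>
    mulop k psi f - mulop k psi (lip_trunc n f)))).
  apply: ereal_inf_lbound.
  by exists (fun f => mulop k psi (lip_trunc n f)) => //; exact: compact_mulop_trunc.
have A0 := A_tail_ge0 n; have B0 := B_tail_ge0 n.
have AP v : (n <= depth v)%N -> ((Normc.normc (psi v))%:E <= A_tail n)%E.
  by move=> nv; apply: ereal_sup_ubound; exists v.
have BP v : v != root -> (n <= depth v)%N ->
    (((depth v)%:R * ln (depth v)%:R * Dmod psi v)%:E <= B_tail n)%E.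
  by move=> vr nv; apply: ereal_sup_ubound; exists v.
(* An infinite tail makes the bound trivial and nonnegativity excludes -oo; real bounds [a] and [b]
   remain. *)
case: (A_tail n) A0 AP => [a||]//; last first.
  by move=> _ _; case: (B_tail n) B0 => [b||]// _; rewrite leey.
case: (B_tail n) B0 BP => [b||]//; last by move=> _ _ a0 _; rewrite leey.
move=> b0 BP a0 AP; rewrite !lee_fin in a0 b0.
apply: op_norm_le => f; rewrite !Re_lip_norm -EFinD lee_fin => f1.
have -> : (mulop k psi f - mulop k psi (lip_trunc n f)) =
    (fun v => psi v * (f v - trunc n f v)) :> (T -> R[i]).
  apply/funext => v.
  change (mulop k psi f v - mulop k psi (lip_trunc n f) v =
    psi v * (f v - trunc n f v)).
  by rewrite mulrBr !mulopE.
apply: (wnorm_mul_trunc_le n0 (lip_in f) f1).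
- by rewrite addr_ge0.
- by move=> v nv; rewrite -lee_fin AP.
- by move=> v vr nv; rewrite -lee_fin BP.
Qed.

Lemma ess_norm_mulop_le (k : lip_kind) : mulop_bounded k psi ->
  (ess_norm (mulop k psi) <= A_lim psi + B_lim psi)%E.
Proof.
move=> bk.
have A0 : (0 <= A_lim psi)%E.
  by apply: lime_ge; [exact: A_tail_cvg | near=> n; exact: A_tail_ge0].
have B0 : (0 <= B_lim psi)%E.
  by apply: lime_ge; [exact: B_tail_cvg | near=> n; exact: B_tail_ge0].
(* Nonnegativity of both limits rules out an undefined sum of opposite infinities. *)
have cAB := @cvgeD _ _ eventually_filter _ _ _ _ _ (ge0_adde_def A0 B0) A_tail_cvg B_tail_cvg.
rewrite -(cvg_lim _ cAB)//; apply: lime_ge; first by apply/cvg_ex; eexists; exact: cAB.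
near=> n; apply: ess_norm_mulop_le_tail => //; near: n.
by exists 1%N.
Unshelve. all: by end_near. Qed.

End main_estimate.

Theorem theorem8p3 (R : realType) (T : tree) (psi : T -> R[i]) :
  (mulop_bounded Lw psi <-> mulop_bounded Lw0 psi) /\
  (mulop_bounded Lw psi ->
   forall X : lip_kind, (ess_norm (mulop X psi) <= A_lim psi + B_lim psi)%E).
Proof.
split; first by split; [exact: mulop_bounded_Lw_Lw0|exact: mulop_bounded_Lw0_Lw].
move=> bpsi k; apply: ess_norm_mulop_le.
(* The estimate uses boundedness on the space itself, so for L_{w,0} it is transferred by the
   equivalence. *)
by case: k => //; exact: mulop_bounded_Lw_Lw0.
Qed.
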